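(* Let $\mathcal{X}\subseteq\mathbb{R}^d$ be a nonempty closed convex set, $F:\mathcal X\to\mathbb R$ convex, $\lambda>0$. Then the procedure MLMC (given in the context) with $p=1/2$ and any integer $j_0\ge2$ implements $\mathrm{UnbiasedProx}_{F,\lambda}$; that is, for all $s,x_{\rm prev}\in\mathcal X$ its output $x$ satisfies, with $x^\star=\mathrm{prox}_{F,\lambda}(s)$, $$\mathbb E x=x^\star\quad\text{and}\quad \mathbb E\|x-x^\star\|^2\le\frac{1}{4\lambda}\left(\lambda V^{\mathrm e}_{x^\star}(s)+V^F_{x^\star}(x_{\rm prev})\right).$$ Moreover MLMC makes $2+j_0$ calls to $\mathrm{ApproxProx}_{F,\lambda}$ in expectation.
   Context: $\|\cdot\|$ is the Euclidean norm. $F$ is differentiable at the points of $\mathcal X$. For $s\in\mathcal X$, $F^\lambda_s(x):=F(x)+\frac{\lambda}{2}\|x-s\|^2$ and $\mathrm{prox}_{F,\lambda}(s):=\arg\min_{x\in\mathcal X}F^\lambda_s(x)$. Bregman divergences: $V^F_x(x'):=F(x')-F(x)-\langle\nabla F(x),x'-x\rangle$ and $V^{\mathrm e}_x(x'):=\frac12\|x'-x\|^2$. $\mathrm{ApproxProx}_{F,\lambda}(s;x_{\rm init},x_{\rm prev})$ is a (possibly randomized) procedure that, for $s,x_{\rm init},x_{\rm prev}\in\mathcal X$, returns $x\in\mathcal X$ with $\mathbb E F^\lambda_s(x)-F^\lambda_s(x^\star)\le\frac18\left(\lambda V^{\mathrm e}_{x^\star}(x_{\rm init})+V^F_{x^\star}(x_{\rm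 prev})\right)$, where $x^\star=\mathrm{prox}_{F,\lambda}(s)$. Each call uses fresh independent randomness, so the guarantee holds conditionally on the inputs. MLMC (input $s,x_{\rm prev}\in\mathcal X$; parameters $p\in[0,1)$, integer $j_0\ge0$): $x^{(0)}=\mathrm{ApproxProx}_{F,\lambda}(s;s,x_{\rm prev})$; sample $J_+\in\{0,1,2,\dots\}$ independently with $\mathbb P[J_+=k]=(1-p)p^k$; $J=j_0+J_+$; for $j=0,\dots,J-1$ set $x^{(j+1)}=\mathrm{ApproxProx}_{F,\lambda}(s;x^{(j)},x^{(j)})$; $p_J=(1-p)p^{J_+}$; return $x^{(j_0)}+p_J^{-1}\left(x^{(J)}-x^{(\max\{J-1,j_0\})}\right)$. *)

(* Defs.v *)
From HB Require Import structures.
From mathcomp Require Import all_boot all_order all_algebra.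
From mathcomp Require Import all_classical all_reals all_analysis.

Set Implicit Arguments.
Unset Strict Implicit.
Unset Printing Implicit Defensive.

Import Order.TTheory GRing.Theory Num.Theory.
Import numFieldNormedType.Exports.

Local Open Scope classical_set_scope.
Local Open Scope ring_scope.

Section Euclidean.
Context {R : realType} {d : nat}.
Implicit Types x y : 'rV[R]_d.

Definition dot x y : R := \sum_(i < d) x ord0 i * y ord0 i.

(* The norm [`|x|] that the library puts on row vectors is the sup norm. *)
Definition enorm x : R := Num.sqrt (dot x x).

End Euclidean.

Notation borel_rV R d := (g_sigma_algebraType (@open 'rV[R]_d)).

Section Prox.
Context {R : realType} {d : nat}.
Local Notation E := 'rV[R]_d.

(* A function F : X -> R is represented by a total function F : E -> R of which
   only the values on X are used.  Accordingly g is a gradient of F at x when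
   F y = F x + <g, y - x> + o(|y - x|) as y tends to x within X; if x is
   interior to X this is ordinary differentiability. *)
Definition is_gradient (X : set E) (F : E -> R) (x g : E) : Prop :=
  forall e : R, 0 < e -> \forall y \near within X (nbhs x),
    `|F y - F x - dot g (y - x)| <= e * enorm (y - x).

Definition differentiable_on (X : set E) (F : E -> R) : Prop :=
  forall x, X x -> exists g, is_gradient X F x g.

(* For X convex, two gradients of F at x in X have the same inner product with
   y - x for every y in X, so the choice made here does not affect [bregman]
   at points of X. *)
Definition grad (X : set E) (F : E -> R) (x : E) : E :=
  xget 0 [set g | is_gradient X F x g].

Definition bregman (X : set E) (F : E -> R) (x x' : E) : R :=
  F x' - F x - dot (grad X F x) (x' - x).

Definition bregman_e (x x' : E) : R := 2^-1 * enorm (x' - x) ^+ 2.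

Definition reg (F : E -> R) (lam : R) (s x : E) : R :=
  F x + lam / 2 * enorm (x - s) ^+ 2.

Definition prox (X : set E) (F : E -> R) (lam : R) (s : E) : E :=
  xget 0 [set x | X x /\ forall y, X y -> reg F lam s x <= reg F lam s y].

End Prox.

(* A randomized procedure with inputs s, x_init, x_prev is a function of the
   inputs and of a seed drawn from the probability space (S, PS).  The expected
   value below is always meaningful, possibly +oo, because [reg F lam s] is
   bounded below on X. *)
Record is_approx_prox (R : realType) (d : nat) (X : set 'rV[R]_d)
    (F : 'rV[R]_d -> R) (lam : R)
    (dS : measure_display) (S : measurableType dS) (PS : probability S R)
    (A : 'rV[R]_d -> 'rV[R]_d -> 'rV[R]_d -> S -> 'rV[R]_d) : Prop := {
  approx_prox_measurable :
    measurable_fun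
      [set u : (borel_rV R d * borel_rV R d * borel_rV R d * S)%type |
        [/\ X u.1.1.1, X u.1.1.2 & X u.1.2]]
      (fun u => A u.1.1.1 u.1.1.2 u.1.2 u.2 : borel_rV R d) ;
  approx_prox_in : forall s xinit xprev z,
    X s -> X xinit -> X xprev -> X (A s xinit xprev z) ;
  approx_prox_le : forall s xinit xprev, X s -> X xinit -> X xprev ->
    let xs := prox X F lam s in
    ('E_PS[fun z => reg F lam s (A s xinit xprev z)] - (reg F lam s xs)%:E
      <= (8^-1 * (lam * bregman_e xs xinit + bregman X F xs xprev))%:E)%E
}.

(* The product rule for all finite subfamilies of a family of event classes. *)
Definition mutually_independent (R : realType) (dO : measure_display)
    (O : measurableType dO) (P : probability O R) (I : eqType)
    (G : I -> set (set O)) : Prop :=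
  forall (r : seq I) (B : I -> set O), uniq r ->
    (forall i, i \in r -> G i (B i)) ->
    P (\bigcap_(i in [set` r]) B i) = (\prod_(i <- r) P (B i))%E.

(* The randomness of one run of MLMC: seeds xi 0, xi 1, ... of law PS, and J_+
   geometric, all mutually independent; index [None] stands for J_+ and
   [Some n] for xi n. *)
Record mlmc_randomness (R : realType) (dS : measure_display)
    (S : measurableType dS) (PS : probability S R) (dO : measure_display)
    (O : measurableType dO) (P : probability O R) (p : R)
    (xi : nat -> {RV P >-> S}) (Jp : {RV P >-> nat}) : Prop := {
  seed_law : forall n B, measurable B -> distribution P (xi n) B = PS B ;
  Jp_law : forall k : nat, distribution P Jp [set k] = ((1 - p) * p ^+ k)%:E ;
  randomness_indep :
    mutually_independent P (fun i : option nat =>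
      if i is Some n then preimage_set_system setT (xi n) measurable
      else preimage_set_system setT Jp measurable)
}.

Section MLMC.
Context {R : realType} {d : nat} {S : Type}.
Local Notation E := 'rV[R]_d.
Variable A : E -> E -> E -> S -> E.
Implicit Types (z : nat -> S) (s xprev : E).

(* The state of a run is the current iterate together with the number c of calls
   to A made so far; the next call consumes the fresh seed z c. *)
Definition call z s (xinit xprev : E) (c : nat) : E * nat :=
  (A s xinit xprev (z c), c.+1).

Fixpoint mlmc_iter z s xprev (j : nat) : E * nat :=
  if j is j'.+1 then
    let st := mlmc_iter z s xprev j' in call z s st.1 st.1 st.2
  else call z s s xprev 0.

(* The output and the number of calls of a run of MLMC in which J_+ = k. *)
Definition mlmc (p : R) (j0 : nat) s xprev z (k : nat) : E * nat :=
  let J := (j0 + k)%N in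
  let pJ := (1 - p) * p ^+ k in
  let x j := (mlmc_iter z s xprev j).1 in
  (x j0 + pJ^-1 *: (x J - x (maxn J.-1 j0)), (mlmc_iter z s xprev J).2).

End MLMC.

(* [U s xprev] is the random output, on the probability space (O, P), of a
   procedure run on the inputs s and xprev. *)
Definition implements_unbiased_prox (R : realType) (d : nat) (X : set 'rV[R]_d)
    (F : 'rV[R]_d -> R) (lam : R) (dO : measure_display)
    (O : measurableType dO) (P : probability O R)
    (U : 'rV[R]_d -> 'rV[R]_d -> O -> 'rV[R]_d) : Prop :=
  forall s xprev, X s -> X xprev ->
    let xs := prox X F lam s in
    [/\ forall i, P.-integrable setT (fun w => (U s xprev w ord0 i)%:E),
        forall i, 'E_P[fun w => U s xprev w ord0 i]%E = (xs ord0 i)%:E &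
        ('E_P[fun w => (enorm (U s xprev w - xs) ^+ 2)%R]
          <= ((4 * lam)^-1 *
              (lam * bregman_e xs s + bregman X F xs xprev))%:E)%E].

(* Main.v *)
Require Import Defs.
From HB Require Import structures.
From mathcomp Require Import all_boot all_order all_algebra.
From mathcomp Require Import all_classical all_reals all_analysis.
From mathcomp Require Import measurable_realfun.
From mathcomp Require Import ring lra.

Set Implicit Arguments.
Unset Strict Implicit.
Unset Printing Implicit Defensive.

Import Order.TTheory GRing.Theory Num.Theory.
Import numFieldNormedType.Exports.

Local Open Scope classical_set_scope.
Local Open Scope ring_scope.

(** Write [xs] for the proximal point and [D] for the right-hand divergence
    [lam * V^e_xs(s) + V^F_xs(xprev)].

    Optimality of [xs] on the convex set [X] says that the gradient of
    [reg F lam s] at [xs] has nonnegative inner product with [y - xs] for every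
    [y] in [X].  Expanding [reg F lam s] around [xs] then gives
    [lam * V^e_xs(y) + V^F_xs(y) <= reg y - reg xs] ([prox_gap]), so the function
    gap bounded by the approximate prox controls the very divergences that appear
    in its guarantee.  Since the inputs of a call are functions of earlier seeds
    only, the guarantee may be integrated against their law, and every call
    divides the expected divergence by at least 8 ([approx_step_contracts]).  Hence
    [E |x^(j) - xs|^2 <= K * 8^-j] with [K = D / (4 * lam)]
    ([iterate_moment]).

    The rest is about any sequence [Y] with such second moments and an independent
    level [N] with [P(N = k) = 2^-(k+1)].  On [N = k] the estimator is
    [Y_j0 + 2^(k+1) (Y_(j0+k) - Y_(j0+k-1))], where the second term is absent for
    [k = 0].  In the mean the weight [2^(k+1)] cancels the probability of the
    level, the corrections telescope, and the sum is [lim E Y_j = xs]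
    ([debiased_mean]).  In the second moment one factor [2^(k+1)] survives but
    is beaten by the [8^-k] decay of the corrections, and summing the
    geometric series gives at most [26 * K * 8^-j0] ([debiased_moment]); for
    [j0 >= 2] this is below [K].  The number of calls is [j0 + N + 1], and [N] has
    mean 1. *)

(** * Inner product and Euclidean norm *)

Section EuclideanSpace.
Context {R : realType} {d : nat}.
Implicit Types (x y g : 'rV[R]_d) (t : R).

Lemma dotC x y : dot x y = dot y x.
Proof. by apply: eq_bigr => i _; rewrite mulrC. Qed.

Lemma dotDr g x y : dot g (x + y) = dot g x + dot g y.
Proof. by rewrite -big_split; apply: eq_bigr => i _; rewrite mxE mulrDr. Qed.

Lemma dotZr g t x : dot g (t *: x) = t * dot g x.
Proof. by rewrite mulr_sumr; apply: eq_bigr => i _; rewrite mxE mulrCA. Qed.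

Lemma dotZl g t x : dot (t *: x) g = t * dot x g.
Proof. by rewrite dotC dotZr dotC. Qed.

Lemma dotBr g x y : dot g (x - y) = dot g x - dot g y.
Proof. by rewrite dotDr -scaleN1r dotZr mulN1r. Qed.

Lemma enorm_sqr x : enorm x ^+ 2 = dot x x.
Proof. by rewrite sqr_sqrtr// sumr_ge0// => i _; rewrite -expr2 sqr_ge0. Qed.

Lemma enormZ t x : 0 <= t -> enorm (t *: x) = t * enorm x.
Proof.
move=> t0; rewrite /enorm dotZr (dotC _ x) dotZr mulrA -expr2 sqrtrM ?sqr_ge0//.
by rewrite sqrtr_sqr ger0_norm.
Qed.

Lemma enorm0 : enorm (0 : 'rV[R]_d) = 0.
Proof. by rewrite -(scale0r 0) enormZ// mul0r. Qed.

Lemma enorm_sqrD x y :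
  enorm (x + y) ^+ 2 = enorm x ^+ 2 + 2 * dot x y + enorm y ^+ 2.
Proof.
rewrite !enorm_sqr !dotDr (dotC (x + y) x) (dotC (x + y) y) !dotDr (dotC y x).
by ring.
Qed.

Lemma enorm_sqrB x y : enorm (x - y) ^+ 2 = enorm (y - x) ^+ 2.
Proof. by rewrite -(opprB y) -scaleN1r !enorm_sqr dotZr dotZl mulrA mulrNN !mul1r. Qed.

Lemma enorm_sqr_le2 x y :
  enorm (x + y) ^+ 2 <= 2 * enorm x ^+ 2 + 2 * enorm y ^+ 2.
Proof.
have := sqr_ge0 (enorm (x - y)); rewrite -(scaleN1r y) !enorm_sqrD dotZr.
rewrite !enorm_sqr dotZr dotZl; lra.
Qed.

Lemma coord_sqr_le x (i : 'I_d) : (x ord0 i) ^+ 2 <= enorm x ^+ 2.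
Proof.
rewrite enorm_sqr /dot (bigD1 i)//= -expr2 lerDl sumr_ge0// => j _.
by rewrite -expr2 sqr_ge0.
Qed.

Lemma continuous_dot g : continuous (dot g).
Proof.
have : continuous (\sum_(i < d) (fun x : 'rV[R]_d => g ord0 i * x ord0 i)).
  elim/big_ind : _ => [|p q cp cq|i _ x].
  - exact: cst_continuous.
  - by move=> x; apply: continuousD; [exact: cp|exact: cq].
  - by apply: continuousM; [exact: cst_continuous|exact: coord_continuous].
by rewrite fct_sumE.
Qed.

Lemma continuous_enorm_sqr y : continuous (fun x => enorm (x - y) ^+ 2).
Proof.
have c : continuous (\sum_(i < d)
    (fun x : 'rV[R]_d => (x ord0 i - y ord0 i) * (x ord0 i - y ord0 i))).
  elim/big_ind : _ => [|p q cp cq|i _ x].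
  - exact: cst_continuous.
  - by move=> x; apply: continuousD; [exact: cp|exact: cq].
  - have cc : {for x, continuous (fun z : 'rV[R]_d => z ord0 i - y ord0 i)}.
      by apply: continuousB; [exact: coord_continuous|exact: cst_continuous].
    exact: (continuousM cc cc).
rewrite (_ : (fun x => _) = \sum_(i < d)
    (fun x : 'rV[R]_d => (x ord0 i - y ord0 i) * (x ord0 i - y ord0 i)))//.
rewrite fct_sumE; apply/funext => x; rewrite enorm_sqr.
by apply: eq_bigr => i _; rewrite !mxE.
Qed.

End EuclideanSpace.

(** * First-order analysis of the proximal problem *)

Section ConvexAnalysis.
Context {R : realType} {d : nat}.
Variables (X : set 'rV[R]_d) (F : 'rV[R]_d -> R).
Hypotheses (hXclosed : closed X) (hXconvex : convex_set X).
Hypotheses (hFconvex : convex_function X F) (hFdiff : differentiable_on X F).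
Implicit Types (x y g s : 'rV[R]_d) (t e lam : R).

Lemma gradP x : X x -> is_gradient X F x (grad X F x).
Proof. by move=> /hFdiff; exact: xgetPex. Qed.

Lemma segment_in x y t : X x -> X y -> 0 <= t <= 1 -> X (x + t *: (y - x)).
Proof.
move=> Xx Xy /andP[t0 t1].
have /set_mem := hXconvex (Itv01 t0 t1) (mem_set Xy) (mem_set Xx).
by rewrite /conv/= scalerBl scale1r scalerBr addrA addrAC addrC.
Qed.

Lemma convex_segment x y t : X x -> X y -> 0 <= t <= 1 ->
  F (x + t *: (y - x)) <= F x + t * (F y - F x).
Proof.
move=> Xx Xy /andP[t0 t1].
have cF : F (t *: y + (1 - t) *: x) <= t * F y + (1 - t) * F x.
  exact: @hFconvex (Itv01 t0 t1) y x (mem_set Xy) (mem_set Xx).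
have -> : x + t *: (y - x) = t *: y + (1 - t) *: x.
  by rewrite scalerBl scale1r scalerBr addrCA.
by apply: (le_trans cF); lra.
Qed.

(** First-order arguments compare [F] at the two ends of a short segment inside [X].
    One point of the segment is enough for them, at a distance [t <= e] that
    makes quadratic terms in [t] as small as the gradient error [t * e]. *)
Lemma gradient_on_segment x y g e : X x -> X y -> is_gradient X F x g ->
  0 < e -> exists t, [/\ 0 < t, t <= 1, t <= e &
    `|F (x + t *: (y - x)) - F x - t * dot g (y - x)| <= t * e].
Proof.
move=> Xx Xy gx e0; set v := y - x.
have n0 : 0 < enorm v + 1 by rewrite ltr_wpDl ?sqrtr_ge0.
have /gx/= : 0 < e / (enorm v + 1) by rewrite divr_gt0.
rewrite near_withinE => gxe.
have cvgx : x + t *: v @[t --> 0^'+] --> x.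
  apply: cvg_at_right_filter.
  rewrite -{2}[x]addr0 -(scale0r v).
  by apply: cvgD; [exact: cvg_cst|apply: cvgZr_tmp; exact: cvg_id].
have {}gxe := cvgx _ gxe.
near (0:R)^'+ => t.
have t0 : 0 < t by near: t; exact: nbhs_right_gt.
have t1 : t <= 1 by near: t; exact: nbhs_right_le.
exists t; split => //; first by near: t; exact: nbhs_right_le.
have Xt : X (x + t *: v) by apply: segment_in; rewrite // ltW.
have /(_ Xt) : X (x + t *: v) -> `|F (x + t *: v) - F x - dot g (x + t *: v - x)| <=
   e / (enorm v + 1) * enorm (x + t *: v - x) by near: t; exact: gxe.
rewrite (addrC x) addrK dotZr (enormZ _ (ltW t0)) => /le_trans; apply.
rewrite mulrCA ler_pM2l// -mulrA ler_piMr ?(ltW e0)//.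
by rewrite mulrC ler_pdivrMr// mul1r lerDl.
Unshelve. all: by end_near. Qed.

(** Convexity bounds [F y - F x] below by the difference quotients of [F] along the
    segment, which approach the inner product with the gradient. *)
Lemma bregman_ge0 x y : X x -> X y -> 0 <= bregman X F x y.
Proof.
move=> Xx Xy; rewrite /bregman subr_ge0; apply/ler_addgt0Pr => e e0.
have [t [t0 t1 _]] := gradient_on_segment Xx Xy (gradP Xx) e0.
rewrite ler_norml => /andP[+ _].
have := convex_segment Xx Xy (t := t); rewrite t1 (ltW t0) => /(_ isT) h1 h2.
rewrite -(ler_pM2l t0); lra.
Qed.

Lemma bregman_e_ge0 x y : 0 <= bregman_e x y.
Proof. by rewrite mulr_ge0 ?sqr_ge0// invr_ge0. Qed.

Lemma within_continuousF : {within X, continuous F}.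
Proof.
apply/subspace_continuousP => x Xx.
apply/cvgrPdist_lt => e e0; rewrite /from_subspace.
have e2 : 0 < e / 2 by rewrite divr_gt0.
have gx := gradP Xx; set g := grad X F x in gx.
have cg : \forall y \near nbhs x, `|dot g (y - x)| < e / 2.
  have : dot g y @[y --> x] --> dot g x by exact: continuous_dot.
  move/cvgrPdist_lt => /(_ _ e2); apply: filterS => y.
  by rewrite distrC -dotBr.
have cn : \forall y \near nbhs x, enorm (y - x) < e / 2.
  have : enorm (y - x) ^+ 2 @[y --> x] --> enorm (x - x) ^+ 2.
    exact: continuous_enorm_sqr.
  move/cvgrPdist_lt => /(_ ((e / 2) ^+ 2)); rewrite exprn_gt0// => /(_ isT).
  apply: filterS => y; rewrite {1}subrr enorm0 expr0n sub0r.
  rewrite normrN ger0_norm ?sqr_ge0// ltr_pXn2r ?nnegrE ?sqrtr_ge0// ltW//.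
near=> y.
have Xy : X y by near: y; exact: withinT.
have gy : `|F y - F x - dot g (y - x)| <= 1 * enorm (y - x).
  by near: y; exact: gx.
have h1 : `|dot g (y - x)| < e / 2 by near: y; exact: cvg_within.
have h2 : enorm (y - x) < e / 2 by near: y; exact: cvg_within.
move: gy h1; rewrite distrC !ltr_norml ler_norml => /andP[? ?] /andP[? ?].
by apply/andP; split; lra.
Unshelve. all: by end_near. Qed.

Section Prox.
Variables (lam : R) (s : 'rV[R]_d).
Hypotheses (hlam : 0 < lam) (Xs : X s).
Local Notation xs := (prox X F lam s).

Lemma within_continuous_reg : {within X, continuous (reg F lam s)}.
Proof.
apply: within_continuousD; first exact: within_continuousF.
apply: continuous_subspaceT => x.
exact: (continuousM (@cst_continuous _ _ (lam / 2) x)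
  (@continuous_enorm_sqr _ _ s x)).
Qed.

(** The linear lower bound of [F] at [s] loses against the quadratic regularizer
    outside a ball around [s], so that a minimizer may be sought in a compact set.
    The radius is the one for which completing the square succeeds. *)
Lemma reg_far y (g := grad X F s) : X y ->
  4 / lam ^+ 2 * enorm g ^+ 2 <= enorm (y - s) ^+ 2 ->
  reg F lam s s <= reg F lam s y.
Proof.
move=> Xy far; have := bregman_ge0 Xs Xy; rewrite /bregman -/g /reg.
(* The square that bounds the inner product of [g] and [y - s] from below. *)
have := sqr_ge0 (enorm ((2 / lam) *: g + (y - s))).
rewrite (enorm_sqrD _ (y - s)) dotZl subrr enorm0.
rewrite expr0n/= mulr0 addr0 enormZ ?divr_ge0 ?(ltW hlam)// exprMn; move: far.
set N := enorm g ^+ 2; set D := enorm (y - s) ^+ 2; set p := dot g (y - s).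
move=> far sq br.
have sq' : 0 <= lam / 4 * ((2 / lam) ^+ 2 * N + 2 * (2 / lam * p) + D).
  by rewrite mulr_ge0// divr_ge0// ltW.
have : lam / 4 * ((2 / lam) ^+ 2 * N + 2 * (2 / lam * p) + D) <=
   lam / 4 * D + p + lam / 4 * D.
  rewrite !mulrDr; apply: lerD => //; apply: lerD.
    rewrite ler_pM2l ?divr_gt0// (le_trans _ far)// expr_div_n.
    by rewrite -natrX.
  by rewrite le_eqVlt; apply/orP; left; apply/eqP; field; rewrite gt_eqF.
lra.
Qed.

Lemma reg_has_min : exists x, X x /\ forall y, X y -> reg F lam s x <= reg F lam s y.
Proof.
pose C : R := 4 / lam ^+ 2 * enorm (grad X F s) ^+ 2.
have C0 : 0 <= C by rewrite mulr_ge0 ?sqr_ge0// divr_ge0 ?sqr_ge0.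
pose B := [set y | enorm (y - s) ^+ 2 <= C].
have cB : closed B.
  apply: (@closed_comp _ _ (fun y => enorm (y - s) ^+ 2) [set r | r <= C]).
    by move=> y _; exact: continuous_enorm_sqr.
  exact: closed_le.
have bB : bounded_set B.
  exists (`|s| + C + 1); split; first by rewrite num_real.
  move=> M MC y By; apply: le_trans (ltW MC); rewrite -addrA -lerBlDl.
  apply: le_trans (lerB_dist _ _) _; rewrite [leLHS]/Num.norm/= mx_normrE.
  apply/bigmax_leP; split => [|[i j] _ /=]; first by rewrite addr_ge0.
  rewrite (ord1 i); have := le_trans (coord_sqr_le (y - s) j) By.
  have : 0 <= (`|(y - s) ord0 j| - 1) ^+ 2 by exact: sqr_ge0.
  by rewrite -(real_normK (num_real ((y - s) ord0 j))); nra.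
have Bs : B s by rewrite /B/= subrr enorm0 expr0n.
have [x xK xmin] : exists2 x, x \in X `&` B &
    forall y, y \in X `&` B -> reg F lam s x <= reg F lam s y.
  apply: EVT_min_rV.
  - by exists s.
  - apply: bounded_closed_compact; last exact: closedI.
    by case: bB => M [Mr MB]; exists M; split => // N /MB + y [_ By]; apply.
  - by apply: continuous_subspaceW within_continuous_reg; exact: subIsetl.
move: xK; rewrite inE => -[Xx _]; exists x; split => // y Xy.
have [By|/ltW/(reg_far Xy)] := leP (enorm (y - s) ^+ 2) C.
  by apply: xmin; rewrite inE.
apply: le_trans.
by apply: xmin; rewrite inE.
Qed.

Lemma prox_in : X xs.
Proof. by have [] := xgetPex 0 reg_has_min. Qed.

Lemma prox_min y : X y -> reg F lam s xs <= reg F lam s y.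
Proof. by have [_] := xgetPex 0 reg_has_min; apply. Qed.

(** Moving from [xs] towards [y] by a fraction [t] cannot decrease the objective;
    dividing by [t] and letting it tend to 0 leaves the directional derivative. *)
Lemma prox_optimality y : X y ->
  0 <= dot (grad X F xs) (y - xs) + lam * dot (xs - s) (y - xs).
Proof.
move=> Xy; set g := grad X F xs; set v := y - xs.
have K0 : 0 < 1 + lam / 2 * enorm v ^+ 2.
  by rewrite ltr_wpDr// mulr_ge0 ?sqr_ge0// divr_ge0// ltW.
(* The accuracy [e / K] absorbs both the gradient error and the quadratic term. *)
apply/ler_addgt0Pr => e e0; set K := _ + _ in K0.
have eK : 0 < e / K by rewrite divr_gt0.
have [t [t0 t1 te]] := gradient_on_segment prox_in Xy (gradP prox_in) eK.
rewrite -/g -/v ler_norml => /andP[_ up].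
have Xt : X (xs + t *: v) by apply: segment_in => //; [exact: prox_in|rewrite (ltW t0)].
have := prox_min Xt; rewrite /reg (addrAC xs) (enorm_sqrD (xs - s)) dotZr.
rewrite (enormZ _ (ltW t0)) exprMn => mn; rewrite -(ler_pM2l t0) mulr0.
have : t * (t * (lam / 2 * enorm v ^+ 2)) <= t * (e / K * (lam / 2 * enorm v ^+ 2)).
  by rewrite ler_pM2l// ler_wpM2r// mulr_ge0 ?sqr_ge0// divr_ge0// ltW.
have : e = e / K + e / K * (lam / 2 * enorm v ^+ 2).
  by rewrite -{1}[e / K]mulr1 -mulrDr divfK// gt_eqF.
move: up mn; set q := enorm v ^+ 2; set D := dot (xs - s) v; set p := dot g v.
move=> up mn eE le; rewrite eE; lra.
Qed.

(** Strong convexity at the minimizer: expanding [reg F lam s] around [xs] leaves the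
    two divergences plus a linear term, which is nonnegative by optimality. *)
Lemma prox_gap y : X y ->
  lam * bregman_e xs y + bregman X F xs y <= reg F lam s y - reg F lam s xs.
Proof.
move=> /prox_optimality; rewrite /bregman_e /bregman /reg.
have -> : y - s = (xs - s) + (y - xs) by rewrite [RHS]addrC addrA subrK.
rewrite (enorm_sqrD (xs - s)); lra.
Qed.

End Prox.
End ConvexAnalysis.

(** * Borel measurability *)

Section Borel.
Context {R : realType} {d : nat}.

Lemma closed_borel_measurable (X : set 'rV[R]_d) :
  closed X -> measurable (X : set (borel_rV R d)).
Proof.
move=> cX; rewrite -(setCK X); apply: measurableC; apply: sub_sigma_algebra.
exact: closed_openC.
Qed.

Lemma within_continuous_measurable (X : set 'rV[R]_d) (f : 'rV[R]_d -> R) :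
  closed X -> {within X, continuous f} ->
  measurable_fun (X : set (borel_rV R d)) (f : borel_rV R d -> R).
Proof.
move=> cX /continuousP cf.
apply: (measurability _ (RGenOpens.measurableE R)).
move=> _ [_ [a [b ->] <-]].
have /cf/open_subspaceP[V oV VX] : open `]a, b[%classic by exact: interval_open.
rewrite setIC -[X in measurable X]VX; apply: measurableI.
  exact: sub_sigma_algebra.
exact: closed_borel_measurable.
Qed.

Lemma continuous_measurable (f : 'rV[R]_d -> R) : continuous f ->
  measurable_fun setT (f : borel_rV R d -> R).
Proof.
move=> cf; apply: within_continuous_measurable; first exact: closedT.
exact: continuous_subspaceT.
Qed.

Lemma measurable_enorm_sqr (y : 'rV[R]_d) :
  measurable_fun setT (fun x : borel_rV R d => enorm (x - y) ^+ 2).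
Proof. by apply: continuous_measurable; exact: continuous_enorm_sqr. Qed.

End Borel.

(** * Independence *)

Section IndependentPair.
Local Open Scope ereal_scope.
Context {R : realType} {dO : measure_display} {O : measurableType dO}.
Context (P : probability O R).
Context {d1 d2 : measure_display} {T1 : measurableType d1} {T2 : measurableType d2}.
Variables (Y : {mfun O >-> T1}) (Z : {mfun O >-> T2}).

Let YZ w := (Y w, Z w).

Let mYZ : measurable_fun setT YZ.
Proof. exact: measurable_fun_pair. Qed.

(** Independence of an event from [Y] and [Z] jointly need only be tested on
    rectangles: they form a pi-system generating the product sigma-algebra. The
    two measures compared are [P] restricted to [C] and [P] scaled by [P C]. *)
Lemma indep_pair_event (C : set O) : measurable C ->
  (forall A B, measurable A -> measurable B ->
    P (Y @^-1` A `&` Z @^-1` B `&` C) = P (Y @^-1` A `&` Z @^-1` B) * P C) ->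
  forall M, measurable M -> P (YZ @^-1` M `&` C) = P (YZ @^-1` M) * P C.
Proof.
move=> mC ABC M mM.
pose m1 : {measure set (T1 * T2)%type -> \bar R} :=
  pushforward (mrestr P mC) YZ.
pose c : {nonneg R} := NngNum (fine_ge0 (measure_ge0 P C)).
have cE : c%:num%:E = P C by rewrite /= fineK// fin_num_measure.
pose m2 : {measure set (T1 * T2)%type -> \bar R} :=
  mscale c (pushforward P YZ).
suff : m1 mYZ M = m2 mYZ M by rewrite /m1/m2/= /mscale/= cE muleC.
pose G := [set A `*` B | A in @measurable _ T1 & B in @measurable _ T2].
apply: (measure_unique G (fun=> setT)) => //.
- exact: measurable_prod_measurableType.
- move=> _ _ [A mA [B mB <-]] [A' mA' [B' mB' <-]]; rewrite -setXI.
  exists (A `&` A'); first exact: measurableI.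
  by exists (B `&` B') => //; exact: measurableI.
- by move=> _; exists setT => //; exists setT => //; rewrite setXTT.
- by rewrite bigcup_const.
- move=> _ [A mA [B mB <-]]; rewrite /m1/m2/= /mscale/= cE muleC.
  exact: ABC.
- move=> _; rewrite /m1/= /pushforward/= /mrestr preimage_setT setTI.
  by rewrite (le_lt_trans (probability_le1 _ _)) ?ltry.
Qed.

Hypothesis YZ_indep : forall A B, measurable A -> measurable B ->
  P (Y @^-1` A `&` Z @^-1` B) = P (Y @^-1` A) * P (Z @^-1` B).

(** The joint law of independent variables is the product of their laws, to which
    the Tonelli theorem applies. *)
Lemma ge0_integral_indep (h : T1 * T2 -> \bar R) :
  measurable_fun setT h -> (forall u, 0 <= h u) ->
  \int[P]_w h (Y w, Z w) =
  \int[distribution P Y]_y \int[distribution P Z]_z h (y, z).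
Proof.
move=> mh h0; rewrite -fubini_tonelli1//.
pose YZm : {mfun O >-> (T1 * T2)%type} := mfun_Sub (mem_set mYZ).
have -> : \int[P]_w h (Y w, Z w) = \int[distribution P YZm]_u h u.
  by rewrite ge0_integral_distribution.
apply: eq_measure_integral => M mM _.
by apply/esym/product_measure_unique.
Qed.

Lemma ge0_integral_indep_event (f : T1 -> \bar R) (B : set T2) :
  measurable_fun setT f -> (forall y, 0 <= f y) -> measurable B ->
  \int[P]_(w in Z @^-1` B) f (Y w) = P (Z @^-1` B) * \int[P]_w f (Y w).
Proof.
move=> mf f0 mB; rewrite integral_mkcond.
have mI : measurable_fun setT (EFin \o \1_B : T2 -> \bar R).
  by apply/measurable_EFinP; exact: measurable_indic.
transitivity (\int[P]_w (f (Y w) * (\1_B (Z w))%:E)).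
  apply: eq_integral => w _; rewrite patchE indicE.
  have -> : (w \in Z @^-1` B) = (Z w \in B) by apply/idP/idP; rewrite !inE.
  by case: ifPn => _; rewrite ?mule1 ?mule0.
rewrite (ge0_integral_indep (h := fun u => f u.1 * (\1_B u.2)%:E))/=; last 2 first.
- apply: emeasurable_funM; first exact: (measurableT_comp mf measurable_fst).
  exact: measurableT_comp mI measurable_snd.
- by move=> u; rewrite mule_ge0// lee_fin.
transitivity (\int[distribution P Y]_y (P (Z @^-1` B) * f y)).
  apply: eq_integral => y _; rewrite ge0_integralZl//.
  by rewrite integral_indic// setIT muleC.
by rewrite ge0_integralZl// ge0_integral_distribution.
Qed.

Lemma integral_indep_event (f : T1 -> \bar R) (B : set T2) :
  measurable_fun setT f -> P.-integrable setT (f \o Y) -> measurable B ->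
  \int[P]_(w in Z @^-1` B) f (Y w) = P (Z @^-1` B) * \int[P]_w f (Y w).
Proof.
move=> mf fi mB; rewrite integralE [in RHS]integralE.
have pY : (fun w => f (Y w))^\+ = (fun w => f^\+ (Y w)).
  by apply/funext => w; rewrite !funeposE.
have nY : (fun w => f (Y w))^\- = (fun w => f^\- (Y w)).
  by apply/funext => w; rewrite !funenegE.
rewrite pY nY (ge0_integral_indep_event (measurable_funepos mf))//.
rewrite (ge0_integral_indep_event (measurable_funeneg mf))//.
have fin : \int[P]_w f^\+ (Y w) \is a fin_num.
  by rewrite -pY; exact: integrable_pos_fin_num.
rewrite (@muleBr _ _ (\int[P]_w f^\+ (Y w)) (\int[P]_w f^\- (Y w)))//.
- by rewrite fin_num_measure// -[X in measurable X]setTI; exact: measurable_funP.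
- exact: fin_num_adde_defr.
Qed.

End IndependentPair.

Section SeedFamily.
Local Open Scope ereal_scope.
Context {R : realType} {dO : measure_display} {O : measurableType dO}.
Context (P : probability O R) {dS : measure_display} {S : measurableType dS}.
Context (PS : probability S R) (p : R).
Context (xi : nat -> {RV P >-> S}) (Jp : {RV P >-> nat}).
Hypothesis hrand : mlmc_randomness PS p xi Jp.

Definition mlmc_event (i : option nat) : set (set O) :=
  if i is Some n then preimage_set_system setT (xi n) measurable
  else preimage_set_system setT Jp measurable.

Lemma mlmc_event_seed n B : measurable B -> mlmc_event (Some n) (xi n @^-1` B).
Proof. by move=> mB; exists B => //; rewrite setTI. Qed.

Lemma mlmc_event_level B : mlmc_event None (Jp @^-1` B).
Proof. by exists B => //; rewrite setTI. Qed.

Lemma mlmc_event_measurable i B : mlmc_event i B -> measurable B.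
Proof. by case: i => [n|] [C mC <-]; exact: measurable_funP. Qed.

(** Independence of [Y] from the level and the seeds of index at least [n] together.
    The product rule is required for every finite family of such events at once,
    because that is what is preserved when [Y] is updated with the seed [n]. *)
Definition indep_future {dT} {T : measurableType dT} (n : nat) (Y : O -> T) :=
  forall D, measurable D -> forall (r : seq (option nat)) (B : option nat -> set O),
    uniq r -> (forall i, i \in r -> mlmc_event i (B i)) ->
    (forall m, Some m \in r -> (n <= m)%N) ->
    P (Y @^-1` D `&` \bigcap_(i in [set` r]) B i) =
    P (Y @^-1` D) * \prod_(i <- r) P (B i).

Lemma indep_future_cst {dT} {T : measurableType dT} n (t : T) :
  indep_future n (fun _ : O => t).
Proof.
move=> D mD r B ur rB _; rewrite preimage_cst.
have [_|_] := boolP (t \in D); last by rewrite set0I measure0 mul0e.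
by rewrite setTI probability_setT mul1e; exact: (randomness_indep hrand).
Qed.

Lemma indep_future_seed {dT} {T : measurableType dT} n (Y : O -> T) A B :
  indep_future n Y -> measurable A -> measurable B ->
  P (Y @^-1` A `&` xi n @^-1` B) = P (Y @^-1` A) * P (xi n @^-1` B).
Proof.
move=> indY mA mB; have := indY _ mA [:: Some n] (fun=> xi n @^-1` B).
rewrite set_cons1 bigcap_set1 big_seq1; apply => //.
- by move=> i; rewrite inE => /eqP ->; exact: mlmc_event_seed.
- by move=> m; rewrite inE => /eqP[->].
Qed.

(** For fixed events [B] of later seeds, the pair [(Y, xi n)] is independent of their
    intersection: on rectangles this is the hypothesis applied to the family
    extended by the event that [xi n] contributes. *)
Lemma indep_future_step {dT dU} {T : measurableType dT} {U : measurableType dU}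
    n (Y : {mfun O >-> T}) (g : T * S -> U) : measurable_fun setT g ->
  indep_future n Y -> indep_future n.+1 (fun w => g (Y w, xi n w)).
Proof.
move=> mg indY D mD r B ur rB rn.
pose C := \bigcap_(i in [set` r]) B i.
have nr : Some n \notin r by apply/negP => /rn; rewrite ltnn.
have mC : measurable C.
  rewrite /C bigcap_seq big_seq; apply: (big_ind measurable) => //.
  - exact: measurableI.
  - by move=> i /rB /mlmc_event_measurable.
have PC : P C = \prod_(i <- r) P (B i) by exact: (randomness_indep hrand).
have split2 E H (r' := Some n :: r) : measurable E -> measurable H ->
    P (Y @^-1` E `&` xi n @^-1` H `&` C) =
    P (Y @^-1` E) * (P (xi n @^-1` H) * P C).
  move=> mE mH.
  (* The family [B] with the event of the seed [n] added. *)
  pose B' i := if i == Some n then xi n @^-1` H else B i.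
  have B'n : B' (Some n) = xi n @^-1` H by rewrite /B' eqxx.
  have B'r i : i \in r -> B' i = B i.
    by rewrite /B'; case: eqP => // ->; rewrite (negbTE nr).
  have := indY _ mE r' B'; rewrite /r' /= nr ur => /(_ isT).
  rewrite big_cons B'n.
  have -> : \prod_(i <- r) P (B' i) = P C.
    rewrite PC big_seq [in RHS]big_seq.
    by apply: eq_bigr => i ir; rewrite B'r.
  have -> : \bigcap_(i in [set` Some n :: r]) B' i = xi n @^-1` H `&` C.
    rewrite bigcap_seq big_cons B'n -bigcap_seq /C.
    by congr (_ `&` _); apply: eq_bigcapr => i /= ir; rewrite B'r.
  rewrite setIA; apply.
  - move=> i; rewrite inE => /predU1P[->|ir].
      by rewrite B'n; exact: mlmc_event_seed.
    by rewrite B'r//; exact: rB.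
  - by move=> m; rewrite inE => /predU1P[[->]//|/rn/ltnW].
rewrite -PC.
apply: (@indep_pair_event _ _ _ P _ _ _ _ Y (xi n) C mC _ (g @^-1` D)).
- by move=> E H mE mH; rewrite split2// indep_future_seed// muleA.
- by rewrite -[X in measurable X]setTI; exact: mg.
Qed.

Lemma indep_future_level {dT} {T : measurableType dT} n (Y : O -> T) A B :
  indep_future n Y -> measurable A ->
  P (Y @^-1` A `&` Jp @^-1` B) = P (Y @^-1` A) * P (Jp @^-1` B).
Proof.
move=> indY mA; have := indY _ mA [:: None] (fun=> Jp @^-1` B).
rewrite set_cons1 bigcap_set1 big_seq1; apply => //.
by move=> i; rewrite inE => /eqP ->; exact: mlmc_event_level.
Qed.

End SeedFamily.

(** * Contraction by one approximate proximal step *)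

Section LowerBoundedExpectation.
Local Open Scope ereal_scope.
Context {R : realType} {dS : measure_display} {S : measurableType dS}.
Context (PS : probability S R).

(** The expectation of [f] is a difference of integrals of its positive and negative
    parts. The lower bound [m] makes the negative one finite, so if the integral
    of [f - m] were infinite, then so would be the expectation of [f]. *)
Lemma expectation_sub_le (f : S -> R) (m c : R) :
  measurable_fun setT f -> (forall z, (m <= f z)%R) ->
  'E_PS[f] - m%:E <= c%:E -> \int[PS]_z (f z - m)%:E <= c%:E.
Proof.
move=> mf mlef; rewrite unlock => Efc.
have mfm : measurable_fun setT (fun z => (f z - m)%:E).
  by apply/measurable_EFinP; exact: measurable_funB.
have PS1 : PS setT = 1 by exact: probability_setT.
have im : PS.-integrable setT (cst m%:E).
  apply/integrableP; split; first exact: measurable_cst.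
  by rewrite /= integral_cst//= PS1 mule1 ltry.
have fm0 z : 0 <= (f z - m)%:E by rewrite lee_fin subr_ge0.
have [fin|] := ltP (\int[PS]_z (f z - m)%:E) +oo.
  have ifm : PS.-integrable setT (fun z => (f z - m)%:E).
    apply/integrableP; split => //.
    by under eq_integral do rewrite gee0_abs//.
  have if_ : PS.-integrable setT (EFin \o f).
    rewrite (_ : EFin \o f = (fun z => (f z - m)%:E) \+ cst m%:E).
      exact: integrableD.
    by apply/funext => z /=; rewrite -EFinD subrK.
  rewrite (_ : (fun z => _) = (EFin \o f) \- cst m%:E); last first.
    by apply/funext => z /=; rewrite EFinB.
  by rewrite integralB//= integral_cst//= PS1 mule1.
rewrite leye_eq => /eqP ioo.
have mp : measurable_fun setT (EFin \o f)^\+.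
  by apply: measurable_funepos; exact/measurable_EFinP.
have mn : measurable_fun setT (EFin \o f)^\-.
  by apply: measurable_funeneg; exact/measurable_EFinP.
have neg : \int[PS]_z (EFin \o f)^\- z <= `|m|%:E.
  rewrite -[leRHS]mule1 -PS1 -integral_cst//; apply: ge0_le_integral => //.
  move=> z _; rewrite funenegE ge_max !lee_fin normr_ge0 andbT.
  by rewrite -normrN (le_trans _ (ler_norm _))// lerN2.
have pos : \int[PS]_z (EFin \o f)^\+ z = +oo.
  apply/eqP; rewrite -leye_eq leNgt; apply/negP => pfin.
  have : \int[PS]_z (f z - m)%:E < +oo.
    apply: (@le_lt_trans _ _ (\int[PS]_z ((EFin \o f)^\+ z + `|m|%:E))).
      apply: ge0_le_integral => //.
        exact: emeasurable_funD.
      move=> z _; rewrite funeposE EFinB leeD//.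
        by rewrite le_max lexx.
      by rewrite -EFinN lee_fin (le_trans (ler_norm _))// normrN.
    rewrite ge0_integralD//.
    by rewrite integral_cst//= PS1 mule1 lte_add_pinfty ?ltry.
  by rewrite ioo ltxx.
move: Efc; rewrite integralE pos.
have : \int[PS]_z (EFin \o f)^\- z \is a fin_num.
  by rewrite ge0_fin_numE ?(le_lt_trans neg) ?ltry// integral_ge0.
by move/fineK => <-.
Qed.

End LowerBoundedExpectation.

Section Contraction.
Local Open Scope ereal_scope.
Context {R : realType} {d : nat}.
Variables (X : set 'rV[R]_d) (F : 'rV[R]_d -> R) (lam : R).
Hypotheses (hXclosed : closed X) (hXconvex : convex_set X).
Hypotheses (hFconvex : convex_function X F) (hFdiff : differentiable_on X F).
Hypothesis hlam : (0 < lam)%R.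
Context {dS : measure_display} {S : measurableType dS} (PS : probability S R).
Variable A : 'rV[R]_d -> 'rV[R]_d -> 'rV[R]_d -> S -> 'rV[R]_d.
Hypothesis hA : is_approx_prox X F lam PS A.
Variables (s : 'rV[R]_d).
Hypothesis Xs : X s.
Local Notation xs := (prox X F lam s).
Local Notation E := (borel_rV R d).

(** The pair [u] stands for the initial and the previous point of a call. *)
Definition prox_divergence (u : E * E) : R :=
  (lam * bregman_e xs u.1 + bregman X F xs u.2)%R.

Local Notation XX := [set u : E * E | X u.1 /\ X u.2].
Local Notation XXS := [set v : (E * E) * S | X v.1.1 /\ X v.1.2].

Let Xxs : X xs. Proof. exact: prox_in. Qed.

Let mX : measurable (X : set E).
Proof. exact: closed_borel_measurable. Qed.

Let mXX : measurable XX.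
Proof. exact: (measurableX mX mX). Qed.

Let mXXS : measurable XXS.
Proof.
rewrite (_ : XXS = XX `*` setT); first exact: measurableX.
by apply/seteqP; split => v //= [].
Qed.

Let mF : measurable_fun (X : set E) (F : E -> R).
Proof. by apply: within_continuous_measurable => //; exact: within_continuousF. Qed.

Let mreg : measurable_fun (X : set E) (reg F lam s : E -> R).
Proof. by apply: within_continuous_measurable => //; exact: within_continuous_reg. Qed.

Let measurable_prox_divergence : measurable_fun XX prox_divergence.
Proof.
apply: measurable_funD.
  apply: measurable_funM => //; apply: measurable_funM => //.
  apply: measurable_funTS.
  exact: (measurableT_comp (measurable_enorm_sqr xs) measurable_fst).
rewrite /bregman; apply: (measurable_comp mX (f := fun y : E =>
  (F y - F xs - dot (grad X F xs) (y - xs))%R)) => [_ [u [_ Xu] <-]//||].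
  apply: measurable_funB; first exact: measurable_funB.
  under eq_fun do rewrite dotBr.
  apply: measurable_funTS; apply: measurable_funB => //.
  by apply: continuous_measurable; exact: continuous_dot.
exact: measurable_funTS measurable_snd.
Qed.

Lemma measurable_prox_divergence_comp {dO : measure_display}
    {O : measurableType dO} (W : O -> (E * E)%type) :
  measurable_fun setT W -> (forall w, XX (W w)) ->
  measurable_fun setT (fun w => prox_divergence (W w)).
Proof.
move=> mW XW; apply: (measurable_comp mXX _ measurable_prox_divergence mW).
by move=> _ [w _ <-]; exact: XW.
Qed.

Lemma prox_divergence_ge0 u : XX u -> (0 <= prox_divergence u)%R.
Proof.
move=> [X1 X2]; apply: addr_ge0; last exact: bregman_ge0.
by rewrite mulr_ge0 ?bregman_e_ge0// ltW.
Qed.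

(** A call is only measurable on admissible inputs; extending it by a constant gives a
    map that can be composed with random variables. *)
Definition approx_step : (E * E) * S -> E :=
  (fun v => A s v.1.1 v.1.2 v.2) \_ XXS.

Lemma approx_stepE u z : XX u -> approx_step (u, z) = A s u.1 u.2 z.
Proof. by move=> Xu; rewrite /approx_step patchT// inE. Qed.

Lemma approx_step_in u z : XX u -> X (approx_step (u, z)).
Proof.
by move=> Xu; rewrite approx_stepE//; case: Xu => *; apply: (approx_prox_in hA).
Qed.

Let measurable_call : measurable_fun XXS (fun v => A s v.1.1 v.1.2 v.2 : E).
Proof.
pose f (v : (E * E) * S) : E * E * E * S := ((s, v.1.1), v.1.2, v.2).
apply: (measurable_comp _ _ (approx_prox_measurable hA) (g := f)).
- rewrite (_ : [set u | _] = (X `*` X `*` X) `*` setT).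
    by apply: measurableX => //; apply: measurableX => //; exact: measurableX.
  by apply/seteqP; split => -[[[a b] c] z] /= [] => [Xa Xb Xc|[[Xa Xb] Xc] _].
- by move=> _ [v [X1 X2] <-].
- apply: measurable_funTS.
  apply: measurable_fun_pair; last exact: measurable_snd.
  apply: measurable_fun_pair; last first.
    exact: (measurableT_comp measurable_snd measurable_fst).
  apply: measurable_fun_pair; last first.
    exact: (measurableT_comp measurable_fst measurable_fst).
  exact: measurable_cst.
Qed.

Lemma measurable_approx_step : measurable_fun setT approx_step.
Proof. by apply/(measurable_restrictT _ mXXS). Qed.

Lemma approx_step_gap u : XX u ->
  \int[PS]_z (reg F lam s (A s u.1 u.2 z) - reg F lam s xs)%:E <=
  (8^-1 * prox_divergence u)%:E.
Proof.
move=> Xu; have [X1 X2] := Xu; apply: expectation_sub_le.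
- apply: (measurable_comp mX _ mreg (g := fun z => A s u.1 u.2 z : E)).
    by move=> _ [z _ <-]; apply: (approx_prox_in hA).
  rewrite (_ : (fun z => _) = approx_step \o pair u).
    exact: measurableT_comp measurable_approx_step (pair1_measurable u).
  by apply/funext => z /=; rewrite approx_stepE.
- by move=> z; apply: prox_min => //; apply: (approx_prox_in hA).
- exact: (approx_prox_le hA).
Qed.

(** The gap of the output controls both divergences at the output, so the bound
    shrinks by the factor of the guarantee; independence of the seed from the input
    lets the guarantee be integrated against the law of the input. *)
Lemma approx_step_contracts {dO : measure_display} {O : measurableType dO}
    (P : probability O R) (I : {mfun O >-> (E * E)%type}) (z : {mfun O >-> S}) :
  (forall w, XX (I w)) ->
  (forall B, measurable B -> distribution P z B = PS B) ->
  (forall B C, measurable B -> measurable C ->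
    P (I @^-1` B `&` z @^-1` C) = P (I @^-1` B) * P (z @^-1` C)) ->
  \int[P]_w (prox_divergence (approx_step (I w, z w), approx_step (I w, z w)))%:E <=
  8^-1%:E * \int[P]_w (prox_divergence (I w))%:E.
Proof.
move=> XI zlaw indep.
pose Phi := (EFin \o prox_divergence) \_ XX.
have Phi0 u : 0 <= Phi u.
  apply: erestrict_ge0 => v Xv; rewrite lee_fin; exact: prox_divergence_ge0.
have mPhi : measurable_fun setT Phi.
  by apply/(measurable_restrictT _ mXX); exact/measurable_EFinP.
pose gap v := (reg F lam s (A s v.1.1 v.1.2 v.2) - reg F lam s xs)%R.
pose h := (EFin \o gap : (E * E) * S -> \bar R) \_ XXS.
have h0 v : 0 <= h v.
  apply: erestrict_ge0 => {}v [X1 X2]; rewrite lee_fin subr_ge0.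
  by apply: prox_min => //; apply: (approx_prox_in hA).
have mh : measurable_fun setT h.
  apply/(measurable_restrictT _ mXXS); apply/measurable_EFinP.
  apply: measurable_funB => //.
  apply: (measurable_comp mX _ mreg measurable_call).
  by move=> _ [v [X1 X2] <-]; apply: (approx_prox_in hA).
apply: (@le_trans _ _ (\int[P]_w h (I w, z w))).
  apply: ge0_le_integral => //.
  - move=> w _; rewrite lee_fin; apply: prox_divergence_ge0.
    by split; exact: approx_step_in.
  - apply/measurable_EFinP; apply: measurable_prox_divergence_comp.
      apply: measurable_fun_pair => //;
      apply: measurableT_comp measurable_approx_step _; exact: measurable_fun_pair.
    by move=> w; split; exact: approx_step_in.
  - apply: (measurableT_comp mh).
    exact: (measurable_fun_pair (measurable_funPT I) (measurable_funPT z)).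
  - move=> w _.
    have -> : h (I w, z w) = (gap (I w, z w))%:E.
      by rewrite /h patchT// inE; exact: XI.
    rewrite lee_fin /gap/= approx_stepE//.
    by apply: prox_gap => //; case: (XI w) => ? ?; apply: (approx_prox_in hA).
rewrite ge0_integral_indep//.
apply: (@le_trans _ _ (\int[distribution P I]_u (8^-1%:E * Phi u))).
  apply: ge0_le_integral => //.
  - by move=> u _; exact: integral_ge0.
  - exact: measurable_fun_fubini_tonelli_F.
  - exact: measurable_funeM.
  move=> u _; have [uX|uX] := pselect (XX u); last first.
    rewrite integral0_eq ?mule_ge0 ?lee_fin//.
    by move=> c _; rewrite /h patchE memNset.
  rewrite (eq_measure_integral PS) => [|B mB _]; last exact: zlaw.
  rewrite /Phi patchT; last by rewrite inE.
  rewrite -EFinM; apply: le_trans (approx_step_gap uX).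
  rewrite le_eqVlt; apply/orP; left; apply/eqP; apply: eq_integral => c _.
  by rewrite /h patchT// inE.
rewrite ge0_integralZl//.
rewrite ge0_integral_distribution//.
rewrite (@eq_integral _ _ _ P setT (fun w => (prox_divergence (I w))%:E)) // => w _.
by rewrite /= /Phi patchT// inE; exact: XI.
Qed.

End Contraction.

(** * Second moments and averaging over a random level *)

Section SecondMoment.
Local Open Scope ereal_scope.
Context {R : realType} {dO : measure_display} {O : measurableType dO}.
Context (P : probability O R).
Variables (f : O -> R) (c : R).
Hypothesis mf : measurable_fun setT f.

Let P1 : P setT = 1.
Proof. exact: probability_setT. Qed.

Let intc (r : R) : P.-integrable setT (cst r%:E).
Proof.
apply/integrableP; split; first exact: measurable_cst.
by rewrite /= integral_cst//= P1 mule1 ltry.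
Qed.

Let mfc : measurable_fun setT (fun w => (f w - c)%:E).
Proof. by apply/measurable_EFinP; exact: measurable_funB. Qed.

Let msq : measurable_fun setT (fun w => ((f w - c) ^+ 2)%:E).
Proof. by apply/measurable_EFinP; apply: measurable_funX; exact: measurable_funB. Qed.

(** Integrating [|t| <= e + t ^ 2 / e]. It serves as a Cauchy-Schwarz inequality: an [e]
    that tends to 0 more slowly than [V] makes both terms small. *)
Lemma abs_dev_le (e V : R) : (0 < e)%R ->
  \int[P]_w ((f w - c) ^+ 2)%:E <= V%:E ->
  \int[P]_w `|(f w - c)%:E| <= (e + V / e)%:E.
Proof.
move=> e0 hV.
apply: (@le_trans _ _ (\int[P]_w (e%:E + e^-1%:E * ((f w - c) ^+ 2)%:E))).
  apply: ge0_le_integral => //.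
  - exact: measurableT_comp.
  - by apply: emeasurable_funD => //; exact: measurable_funeM.
  move=> w _; rewrite -EFinM -EFinD lee_fin.
  rewrite -(ler_pM2l e0) mulrDr mulrA divff ?gt_eqF// mul1r.
  have := sqr_ge0 (`|f w - c| - e)%R.
  rewrite -(real_normK (num_real (f w - c)%R)).
  have : (0 <= `|f w - c| * e)%R by rewrite mulr_ge0// ltW.
  nra.
have e0' : 0 <= e%:E by rewrite lee_fin ltW.
have ie0 : 0 <= e^-1%:E by rewrite lee_fin invr_ge0 ltW.
have sq0 w : setT w -> 0 <= ((f w - c) ^+ 2)%:E by rewrite lee_fin sqr_ge0.
rewrite ge0_integralD//; first last.
- exact: measurable_funeM.
- by move=> w _; rewrite mule_ge0// sq0.
rewrite integral_cst//= P1 mule1 ge0_integralZl// EFinD leeD2l//.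
by rewrite mulrC EFinM lee_pmul2l// lte_fin invr_gt0.
Qed.

Lemma integrable_of_sqr : \int[P]_w ((f w - c) ^+ 2)%:E < +oo ->
  P.-integrable setT (EFin \o f).
Proof.
move=> fin.
have finE : \int[P]_w ((f w - c) ^+ 2)%:E = (fine (\int[P]_w ((f w - c) ^+ 2)%:E))%:E.
  by rewrite fineK// ge0_fin_numE// integral_ge0// => w _; rewrite lee_fin sqr_ge0.
have ifc : P.-integrable setT (fun w => (f w - c)%:E).
  apply/integrableP; split => //.
  apply: le_lt_trans (abs_dev_le ltr01 _) (ltry _); rewrite finE; exact: lexx.
rewrite (_ : EFin \o f = (fun w => (f w - c)%:E) \+ cst c%:E).
  exact: integrableD.
by apply/funext => w /=; rewrite -EFinD subrK.
Qed.

Lemma expectation_dev_le (e V : R) : (0 < e)%R ->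
  \int[P]_w ((f w - c) ^+ 2)%:E <= V%:E ->
  (`|fine (\int[P]_w (f w)%:E) - c| <= e + V / e)%R.
Proof.
move=> e0 hV; have fi : P.-integrable setT (EFin \o f).
  by apply: integrable_of_sqr; rewrite (le_lt_trans hV) ?ltry.
have ffin : \int[P]_w (f w)%:E \is a fin_num by exact: integrable_fin_num.
rewrite -lee_fin; apply: le_trans (abs_dev_le e0 hV).
apply: le_trans (le_abse_integral _ _ mfc) => //.
rewrite (_ : (fun w => (f w - c)%:E) = (EFin \o f) \- cst c%:E); last first.
  by apply/funext => w /=; rewrite EFinB.
by rewrite integralB//= integral_cst//= P1 mule1 -{2}(fineK ffin).
Qed.

End SecondMoment.

Section Levels.
Local Open Scope ereal_scope.
Context {R : realType} {dO : measure_display} {O : measurableType dO}.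
Context (P : probability O R) (N : {mfun O >-> nat}).
Local Notation level k := (N @^-1` [set k]).

Let mlevel k : measurable (level k).
Proof. by rewrite -[X in measurable X]setTI; exact: measurable_funP. Qed.

Lemma bigcup_level : \bigcup_k level k = setT.
Proof. by apply/seteqP; split => // w _; exists (N w). Qed.

Lemma trivIset_level : trivIset setT (fun k => level k).
Proof. by move=> i j _ _ [w [<- <-]]. Qed.

Lemma measurable_fun_level {dT} {T : measurableType dT} (f : O -> T)
    (g : nat -> O -> T) :
  (forall k, measurable_fun setT (g k)) -> (forall w, f w = g (N w) w) ->
  measurable_fun setT f.
Proof.
move=> mg fg; rewrite -bigcup_level; apply/measurable_fun_bigcup => // k.
apply: (eq_measurable_fun (g k)); last exact: measurable_funTS.
by move=> w; rewrite inE => /= <-; rewrite fg.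
Qed.

Lemma ge0_integral_levels_le (f : O -> \bar R) (C : R) :
  measurable_fun setT f -> (forall w, 0 <= f w) ->
  (forall n, \sum_(0 <= k < n) \int[P]_(w in level k) f w <= C%:E) ->
  \int[P]_w f w <= C%:E.
Proof.
move=> mf f0 fC; rewrite -bigcup_level ge0_integral_bigcup//.
- apply: lime_le; last exact: nearW.
  by apply: is_cvg_ereal_nneg_natsum => k _; exact: integral_ge0.
- by rewrite bigcup_level.
- exact: trivIset_level.
Qed.

Lemma integral_levels (f : O -> \bar R) (a : nat -> R) (l : R) :
  P.-integrable setT f ->
  (forall k, \int[P]_(w in level k) f w = (a k)%:E) ->
  (fun n => \sum_(0 <= k < n) a k)%R @ \oo --> l ->
  \int[P]_w f w = l%:E.
Proof.
move=> fi fa al; rewrite -bigcup_level integral_bigcup//; last 2 first.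
- exact: trivIset_level.
- by rewrite bigcup_level.
apply: cvg_lim => //.
under eq_fun do under eq_bigr do rewrite fa.
under eq_fun do rewrite sumEFin.
by apply: cvg_EFin; [exact: nearW|exact: al].
Qed.

Lemma ge0_integral_levels (f : O -> \bar R) (a : nat -> R) (l : R) :
  measurable_fun setT f -> (forall w, 0 <= f w) ->
  (forall k, \int[P]_(w in level k) f w = (a k)%:E) ->
  (fun n => \sum_(0 <= k < n) a k)%R @ \oo --> l ->
  \int[P]_w f w = l%:E.
Proof.
move=> mf f0 fa al; rewrite -bigcup_level ge0_integral_bigcup//; last 2 first.
- by rewrite bigcup_level.
- exact: trivIset_level.
apply: cvg_lim => //.
under eq_fun do under eq_bigr do rewrite fa.
under eq_fun do rewrite sumEFin.
by apply: cvg_EFin; [exact: nearW|exact: al].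
Qed.

End Levels.

(** * The randomized telescoping estimator *)

Section Debiasing.
Local Open Scope ereal_scope.
Context {R : realType} {d : nat} {dO : measure_display} {O : measurableType dO}.
Context (P : probability O R).
Local Notation E := (borel_rV R d).
Variables (Y : nat -> {mfun O >-> E}) (N : {mfun O >-> nat}).
Variables (xs : 'rV[R]_d) (K : R) (j0 : nat).
Local Notation y j w := (Y j w : 'rV[R]_d).
Local Notation level k := (N @^-1` [set k]).
Local Notation err j w := (enorm (y j w - xs) ^+ 2)%R.

Hypothesis K_ge0 : (0 <= K)%R.
Hypothesis N_law : forall k, P (level k) = (2^-1 ^+ k.+1)%:E.
Hypothesis YN_indep : forall j A B, measurable A -> measurable B ->
  P (Y j @^-1` A `&` N @^-1` B) = P (Y j @^-1` A) * P (N @^-1` B).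
Hypothesis Y_moment : forall j, \int[P]_w (err j w)%:E <= (K * 8^-1 ^+ j)%:E.

Definition debiased_at (k : nat) (w : O) : 'rV[R]_d :=
  y j0 w + (2^-1 ^+ k.+1)^-1 *: (y (j0 + k)%N w - y (maxn (j0 + k).-1 j0) w).

Definition debiased (w : O) : 'rV[R]_d := debiased_at (N w) w.

Let mlevel k : measurable (level k).
Proof. by rewrite -[X in measurable X]setTI; exact: measurable_funP. Qed.

Let mcoord i : measurable_fun setT (fun x : E => (x : 'rV[R]_d) ord0 i).
Proof. by apply: continuous_measurable; exact: coord_continuous. Qed.

Let my j i : measurable_fun setT (fun w => y j w ord0 i).
Proof. exact: (measurableT_comp (mcoord i) (measurable_funPT (Y j))). Qed.

Let merr j : measurable_fun setT (fun w => (err j w)%:E).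
Proof.
apply/measurable_EFinP.
exact: (measurableT_comp (measurable_enorm_sqr xs) (measurable_funPT (Y j))).
Qed.

Lemma measurable_debiased i : measurable_fun setT (fun w => debiased w ord0 i).
Proof.
apply: (measurable_fun_level (N:=N) (g := fun k w => debiased_at k w ord0 i)) => // k.
under eq_fun do rewrite !mxE.
apply: measurable_funD => //; apply: measurable_funM => //.
exact: measurable_funB.
Qed.

Lemma coord_moment j i :
  \int[P]_w ((y j w ord0 i - xs ord0 i) ^+ 2)%:E <= (K * 8^-1 ^+ j)%:E.
Proof.
apply: le_trans (Y_moment j); apply: ge0_le_integral => //.
- by move=> w _; rewrite lee_fin sqr_ge0.
- by apply/measurable_EFinP; apply: measurable_funX; exact: measurable_funB.
- move=> w _; rewrite lee_fin; have := coord_sqr_le (y j w - xs) i.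
  by rewrite !mxE.
Qed.

Let iy j i : P.-integrable setT (fun w => (y j w ord0 i)%:E).
Proof.
apply: (@integrable_of_sqr _ _ _ P _ (xs ord0 i)); first exact: my.
exact: le_lt_trans (coord_moment j i) (ltry _).
Qed.

Let mean j i : R := fine (\int[P]_w (y j w ord0 i)%:E).

Let meanE j i : \int[P]_w (y j w ord0 i)%:E = (mean j i)%:E.
Proof. by rewrite fineK//; exact: integrable_fin_num. Qed.

Let half_exp_cvg : (2^-1 ^+ n)%R @[n --> \oo] --> (0 : R)%R.
Proof. by apply: cvg_expr; rewrite ger0_norm// invf_lt1// ltr1n. Qed.

(** With deviation parameter [2^-j] the two error terms are [2^-j] and [K * 4^-j]. *)
Lemma mean_cvg i : mean j i @[j --> \oo] --> xs ord0 i.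
Proof.
have up : (2^-1 ^+ j * (1 + K))%R @[j --> \oo] --> (0 * (1 + K) : R)%R.
  by apply: cvgMr_tmp; exact: half_exp_cvg.
rewrite mul0r in up.
apply/cvgrPdist_le => e e0.
move/cvgrPdist_le : up => /(_ e e0); apply: filterS => j.
rewrite sub0r normrN => /(le_trans (ler_norm _)) le_e.
rewrite distrC; apply: le_trans le_e.
have h0 : (0 < 2^-1 ^+ j :> R)%R by rewrite exprn_gt0.
apply: (le_trans (expectation_dev_le (my j i) h0 (coord_moment j i))).
have -> : (8^-1 ^+ j = 2^-1 ^+ j * (2^-1 ^+ j * 2^-1 ^+ j) :> R)%R.
  by rewrite -!exprMn; congr (_ ^+ _)%R; lra.
have h1 : (2^-1 ^+ j <= 1 :> R)%R by rewrite exprn_ile1// invf_le1// ler1n.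
move: h0 h1; set a := (2^-1 ^+ j)%R => a0 a1.
have -> : (K * (a * (a * a)) / a = K * a * a)%R by field; rewrite gt_eqF.
have Ka : (0 <= K * a)%R by rewrite mulr_ge0// ltW.
nra.
Qed.

(** Independence factors out the probability of the level, which cancels the weight of
    the correction. *)
Lemma level_mean k i : \int[P]_(w in level k) (debiased w ord0 i)%:E =
  (2^-1 ^+ k.+1 * mean j0 i + (mean (j0 + k) i - mean (maxn (j0 + k).-1 j0) i))%:E.
Proof.
have lm j : \int[P]_(w in level k) (y j w ord0 i)%:E =
    (2^-1 ^+ k.+1 * mean j i)%:E.
  rewrite EFinM -meanE -N_law.
  apply: (integral_indep_event (Y := Y j) (Z := N) _
    (f := fun x : E => ((x : 'rV[R]_d) ord0 i)%:E)) => //.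
  - by move=> A B; exact: YN_indep.
  - by apply/measurable_EFinP; exact: mcoord.
  - exact: iy.
have iyk j : P.-integrable (level k) (fun w => (y j w ord0 i)%:E).
  exact: integrableS (iy j i).
set c := (2^-1 ^+ k.+1 : R)%R in lm *.
have c0 : c != 0%R by rewrite expf_neq0// invr_neq0.
pose diff w := (y (j0 + k)%N w ord0 i)%:E - (y (maxn (j0 + k).-1 j0) w ord0 i)%:E.
have idiff : P.-integrable (level k) diff by exact: integrableB.
transitivity (\int[P]_(w in level k) ((y j0 w ord0 i)%:E + c^-1%:E * diff w)).
  apply: eq_integral => w; rewrite inE => /= Nw.
  by rewrite /debiased Nw /debiased_at !mxE /diff -EFinB -EFinM -EFinD.
rewrite integralD//; last exact: integrableZl.
rewrite integralZl// integralB// !lm -EFinB -EFinM -EFinD; congr EFin.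
by rewrite -mulrBr mulKf.
Qed.

Lemma partial_mean i n :
  (\sum_(0 <= k < n.+1) (2^-1 ^+ k.+1 * mean j0 i +
     (mean (j0 + k) i - mean (maxn (j0 + k).-1 j0) i)) =
   mean (j0 + n) i - 2^-1 ^+ n.+1 * mean j0 i)%R.
Proof.
elim: n => [|n ih].
  by rewrite big_nat1 addn0 (maxn_idPr (leq_pred _)) expr1; lra.
rewrite big_nat_recr//= ih addnS/= (maxn_idPl (leq_addr _ _)) [(_ ^+ n.+2)%R]exprS.
by lra.
Qed.

Lemma debiased_level_err0 w : (enorm (debiased_at 0%N w - xs) ^+ 2 = err j0 w)%R.
Proof. by rewrite /debiased_at addn0 (maxn_idPr (leq_pred _)) subrr scaler0 addr0. Qed.

Lemma debiased_level_errS k w : (enorm (debiased_at k.+1 w - xs) ^+ 2 <=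
  2 * err j0 w + 4 * (2^-1 ^+ k.+2) ^- 2 *
    (err (j0 + k.+1)%N w + err (j0 + k)%N w))%R.
Proof.
rewrite /debiased_at addnS/= (maxn_idPl (leq_addr _ _)) addrAC.
set a := (y j0 w - xs)%R; set b := y (j0 + k).+1 w; set b' := y (j0 + k)%N w.
have c0 : (0 <= (2^-1 ^+ k.+2 : R)^-1)%R by rewrite invr_ge0 exprn_ge0.
apply: le_trans (enorm_sqr_le2 _ _) _; rewrite lerD2l (enormZ _ c0) exprMn.
rewrite (exprVn (2^-1 ^+ k.+2)).
have -> : (b - b' = (b - xs) + (xs - b'))%R by rewrite addrA subrK.
have := enorm_sqr_le2 (b - xs) (xs - b'); rewrite (enorm_sqrB xs).
set q := ((2^-1 ^+ k.+2) ^- 2 : R)%R.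
have q0 : (0 <= q)%R by rewrite invr_ge0 sqr_ge0.
move=> /(ler_wpM2l q0); lra.
Qed.

Lemma level_err k j : \int[P]_(w in level k) (err j w)%:E <=
  (2^-1 ^+ k.+1 * (K * 8^-1 ^+ j))%:E.
Proof.
have -> : \int[P]_(w in level k) (err j w)%:E =
    P (level k) * \int[P]_w (err j w)%:E.
  apply: (ge0_integral_indep_event (Y := Y j) (Z := N) _
    (f := fun x : E => (enorm ((x : 'rV[R]_d) - xs) ^+ 2)%:E)) => //.
  - by move=> A B; exact: YN_indep.
  - by apply/measurable_EFinP; exact: measurable_enorm_sqr.
  - by move=> x; rewrite lee_fin sqr_ge0.
by rewrite N_law EFinM lee_pmul2l// lte_fin exprn_gt0.
Qed.

Lemma measurable_debiased_err :
  measurable_fun setT (fun w => (enorm (debiased w - xs) ^+ 2)%R).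
Proof.
under eq_fun do rewrite enorm_sqr /dot.
apply: measurable_sum => i.
have -> : (fun w => (debiased w - xs) ord0 i * (debiased w - xs) ord0 i)%R =
    (fun w => (debiased w ord0 i - xs ord0 i) * (debiased w ord0 i - xs ord0 i))%R.
  by apply/funext => w; rewrite mxE [X in (_ + X)%R]mxE.
by apply: measurable_funM; apply: measurable_funB => //; exact: measurable_debiased.
Qed.

Let B : R := (K * 8^-1 ^+ j0)%R.

Lemma level_moment0 :
  \int[P]_(w in level 0%N) (enorm (debiased w - xs) ^+ 2)%:E <= (2^-1 * B)%:E.
Proof.
have -> : \int[P]_(w in level 0%N) (enorm (debiased w - xs) ^+ 2)%:E =
    \int[P]_(w in level 0%N) (err j0 w)%:E.
  apply: eq_integral => w; rewrite inE => /= Nw.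
  by rewrite /debiased Nw debiased_level_err0.
by apply: (le_trans (level_err 0%N j0)); rewrite expr1.
Qed.

(** With [t = 2^-(k+1)], the level has probability [t / 2] and the squared weight of
    the correction is [4 / t^2], while the errors at [j0 + k + 1] and [j0 + k] have
    second moments at most [B * t^3] and [8 * B * t^3]. This leaves [t * B] for
    the base term and [72 * t^2 * B] for the correction. *)
Lemma level_momentS k :
  \int[P]_(w in level k.+1) (enorm (debiased w - xs) ^+ 2)%:E <=
  (B * (2^-1 ^+ k.+1 + 72 * (2^-1 ^+ k.+1 * 2^-1 ^+ k.+1)))%:E.
Proof.
pose q : R := (4 * (2^-1 ^+ k.+2) ^- 2)%R.
have q0 : (0 <= q)%R by rewrite mulr_ge0// invr_ge0 sqr_ge0.
have mk j : measurable_fun (level k.+1) (fun w => (err j w)%:E).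
  exact: measurable_funTS.
have e0 j w : level k.+1 w -> 0 <= (err j w)%:E by rewrite lee_fin sqr_ge0.
pose S w := (err (j0 + k.+1)%N w)%:E + (err (j0 + k)%N w)%:E.
have S0 w : level k.+1 w -> 0 <= S w by move=> Nw; rewrite adde_ge0 ?e0.
have mS : measurable_fun (level k.+1) S by exact: emeasurable_funD.
apply: (@le_trans _ _ (\int[P]_(w in level k.+1)
    (2%:E * (err j0 w)%:E + q%:E * S w))).
  apply: ge0_le_integral => //.
  - by move=> w _; rewrite lee_fin sqr_ge0.
  - by apply/measurable_EFinP; apply: measurable_funTS; exact: measurable_debiased_err.
  - by apply: emeasurable_funD; exact: measurable_funeM.
  move=> w /= Nw; rewrite /S -EFinD lee_fin /debiased Nw.
  exact: debiased_level_errS.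
rewrite ge0_integralD//; first last.
- exact: measurable_funeM.
- by move=> w Nw; rewrite mule_ge0 ?S0 ?lee_fin.
- exact: measurable_funeM.
- by move=> w Nw; rewrite mule_ge0 ?e0 ?lee_fin.
rewrite !ge0_integralZl ?lee_fin//; last exact: e0.
rewrite ge0_integralD//; [|exact: e0|exact: e0].
pose b j : R := (2^-1 ^+ k.+2 * (K * 8^-1 ^+ j))%R.
apply: (@le_trans _ _ (2%:E * (b j0)%:E +
    q%:E * ((b (j0 + k.+1)%N)%:E + (b (j0 + k)%N)%:E))).
  apply: leeD; apply: lee_wpmul2l; rewrite ?lee_fin//; first exact: level_err.
  by apply: leeD; exact: level_err.
rewrite -EFinD lee_fin /b /q addnS (exprS 8^-1 (j0 + k)) (exprD 8^-1).
have -> : (8^-1 ^+ k = 2^-1 ^+ k * 2^-1 ^+ k * 2^-1 ^+ k :> R)%R.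
  by rewrite -!exprMn; congr (_ ^+ _)%R; lra.
rewrite !(exprS 2^-1) expr2 /B; set a := (2^-1 ^+ k)%R; set c := (8^-1 ^+ j0)%R.
have a0 : a != 0%R by rewrite expf_neq0// invr_neq0.
by rewrite le_eqVlt; apply/orP; left; apply/eqP; field; rewrite a0.
Qed.

Lemma debiased_moment :
  \int[P]_w (enorm (debiased w - xs) ^+ 2)%:E <= (26 * B)%:E.
Proof.
have B0 : (0 <= B)%R by rewrite mulr_ge0// exprn_ge0.
apply: (ge0_integral_levels_le (N := N)).
- by apply/measurable_EFinP; exact: measurable_debiased_err.
- by move=> w; rewrite lee_fin sqr_ge0.
pose h n : R := (2^-1 ^+ n)%R.
have h0 n : (0 <= h n)%R by exact: exprn_ge0.
(* The bracket is 26 minus multiples of the tails of the series of [2^-k] and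
   [4^-k], which makes the induction step an identity. *)
suff partial n : \sum_(0 <= k < n.+1)
    \int[P]_(w in level k) (enorm (debiased w - xs) ^+ 2)%:E <=
    (B * (26 - h n - 24 * (h n * h n)))%:E.
  case=> [|n]; first by rewrite big_nil lee_fin mulr_ge0.
  apply: le_trans (partial n) _; rewrite lee_fin mulrC ler_wpM2r//.
  by have := h0 n; have := mulr_ge0 (h0 n) (h0 n); lra.
elim: n => [|n ih].
  rewrite big_nat1; apply: le_trans level_moment0 _; rewrite lee_fin /h expr0; lra.
rewrite big_nat_recr//=; apply: le_trans (leeD ih (level_momentS n)) _.
by rewrite -EFinD lee_fin -/(h n.+1) /h exprS -/(h n); lra.
Qed.

Lemma integrable_debiased i : P.-integrable setT (fun w => (debiased w ord0 i)%:E).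
Proof.
apply: (@integrable_of_sqr _ _ _ P _ (xs ord0 i)); first exact: measurable_debiased.
apply: le_lt_trans (ltry (26 * B)); apply: le_trans debiased_moment.
apply: ge0_le_integral => //.
- by move=> w _; rewrite lee_fin sqr_ge0.
- apply/measurable_EFinP; apply: measurable_funX; apply: measurable_funB => //.
  exact: measurable_debiased.
- by apply/measurable_EFinP; exact: measurable_debiased_err.
- move=> w _; rewrite lee_fin; have := coord_sqr_le (debiased w - xs) i.
  by rewrite mxE [X in (_ + X)%R]mxE.
Qed.

Lemma debiased_mean i : \int[P]_w (debiased w ord0 i)%:E = (xs ord0 i)%:E.
Proof.
apply: (integral_levels (integrable_debiased i) (level_mean^~ i)).
rewrite -cvg_shiftS /=; under eq_fun do rewrite partial_mean.
have lim : (mean (j0 + n) i - 2^-1 ^+ n.+1 * mean j0 i)%R @[n --> \oo] -->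
    (xs ord0 i - 0 * mean j0 i)%R.
  apply: cvgB.
    have := @mean_cvg i; rewrite -(cvg_shiftn j0) /=.
    by under eq_fun do rewrite addnC.
  apply: cvgMr_tmp.
  by have := half_exp_cvg; rewrite -cvg_shiftS.
by rewrite mul0r subr0 in lim.
Qed.

End Debiasing.

(** * Mean of the geometric level *)

Section GeometricMean.
Context {R : realType}.

Lemma sum_arith_geometric (c n : nat) :
  \sum_(0 <= k < n) ((c + k).+1%:R * 2^-1 ^+ k.+1 : R) =
  (2 + c)%:R - (n + (2 + c))%:R * 2^-1 ^+ n.
Proof.
elim: n => [|n ih]; first by rewrite big_nil add0n expr0 mulr1 subrr.
rewrite big_nat_recr//= ih exprS.
have -> : (c + n).+1%:R = n%:R + c%:R + 1 :> R by rewrite -addn1 addnC !natrD; lra.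
have -> : (n.+1 + (2 + c))%:R = n%:R + c%:R + 3 :> R.
  by rewrite -addn1 !natrD; lra.
have -> : (n + (2 + c))%:R = n%:R + c%:R + 2 :> R by rewrite !natrD; lra.
lra.
Qed.

(** Domination by a geometric sequence, so that [n / 2^n] tends to 0. *)
Lemma natr_half_exp_le (n : nat) : n%:R * 2^-1 ^+ n <= 2 * (3 / 4) ^+ n :> R.
Proof.
elim: n => [|n ih]; first by rewrite mul0r mulr_ge0// exprn_ge0// divr_ge0.
have h34 : 2^-1 ^+ n <= (3 / 4) ^+ n :> R by rewrite lerXn2r ?nnegrE//; lra.
rewrite !exprS -[n.+1]addn1 natrD; lra.
Qed.

Lemma cvg_sum_arith_geometric (c : nat) :
  \sum_(0 <= k < n) ((c + k).+1%:R * 2^-1 ^+ k.+1 : R) @[n --> \oo] -->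
  ((2 + c)%:R : R).
Proof.
under eq_fun => n do rewrite sum_arith_geometric (natrD _ n) mulrDl.
have l1 : n%:R * 2^-1 ^+ n @[n --> \oo] --> (0 : R).
  apply: (@squeeze_cvgr _ _ _ _ (cst 0) (fun n => 2 * (3 / 4) ^+ n)).
  - by apply: nearW => n; rewrite mulr_ge0 ?exprn_ge0//= natr_half_exp_le.
  - exact: cvg_cst.
  - rewrite -(mulr0 2); apply: cvgMl_tmp; apply: cvg_expr.
    by rewrite ger0_norm; lra.
have l2 : (2 + c)%:R * 2^-1 ^+ n @[n --> \oo] --> ((2 + c)%:R * 0 : R).
  by apply: cvgMl_tmp; apply: cvg_expr; rewrite ger0_norm; lra.
have lim : (2 + c)%:R - (n%:R * 2^-1 ^+ n + (2 + c)%:R * 2^-1 ^+ n) @[n --> \oo] -->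
    ((2 + c)%:R - (0 + (2 + c)%:R * 0) : R).
  by apply: cvgB; [exact: cvg_cst|exact: cvgD].
by rewrite mulr0 addr0 subr0 in lim.
Qed.

End GeometricMean.

(** * Runs of MLMC *)

Section Run.
Context {R : realType} {d : nat} {S : Type}.
Variable A : 'rV[R]_d -> 'rV[R]_d -> 'rV[R]_d -> S -> 'rV[R]_d.
Variables (z : nat -> S) (s xprev : 'rV[R]_d).

(** Giving the first call the same form as the others lets one induction on [j] cover
    the measurability, the independence and the decay of all the iterates. *)
Definition mlmc_input (j : nat) : 'rV[R]_d * 'rV[R]_d :=
  if j is j'.+1 then
    ((mlmc_iter A z s xprev j').1, (mlmc_iter A z s xprev j').1)
  else (s, xprev).

Lemma mlmc_iter_calls j : (mlmc_iter A z s xprev j).2 = j.+1.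
Proof. by elim: j => //= j ->. Qed.

Lemma mlmc_iterE j :
  (mlmc_iter A z s xprev j).1 = A s (mlmc_input j).1 (mlmc_input j).2 (z j).
Proof. by case: j => //= j; rewrite mlmc_iter_calls. Qed.

End Run.

Section Unbiased.
Local Open Scope ereal_scope.
Context {R : realType} {d : nat}.
Variables (X : set 'rV[R]_d) (F : 'rV[R]_d -> R) (lam : R).
Hypotheses (hXclosed : closed X) (hXconvex : convex_set X).
Hypotheses (hFconvex : convex_function X F) (hFdiff : differentiable_on X F).
Hypothesis hlam : (0 < lam)%R.
Context {dS : measure_display} {S : measurableType dS} (PS : probability S R).
Variable A : 'rV[R]_d -> 'rV[R]_d -> 'rV[R]_d -> S -> 'rV[R]_d.
Hypothesis hA : is_approx_prox X F lam PS A.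
Context {dO : measure_display} {O : measurableType dO} (P : probability O R).
Context (xi : nat -> {RV P >-> S}) (Jp : {RV P >-> nat}).
Hypothesis hrand : mlmc_randomness PS 2^-1%R xi Jp.
Variables (s xprev : 'rV[R]_d).
Hypotheses (Xs : X s) (Xp : X xprev).
Local Notation xs := (prox X F lam s).
Local Notation E := (borel_rV R d).

Let I j (w : O) : (E * E)%type := mlmc_input A (xi^~ w) s xprev j.
Let x j (w : O) : 'rV[R]_d := (mlmc_iter A (xi^~ w) s xprev j).1.
Let D : R := prox_divergence X F lam s (s, xprev).

Lemma mlmc_input_in j w : X (I j w).1 /\ X (I j w).2.
Proof.
elim: j => [//|j [X1 X2]]; have : X (x j w); last by [].
by rewrite /x mlmc_iterE; apply: (approx_prox_in hA).
Qed.

Lemma mlmc_inputS j w : I j.+1 w =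
  (approx_step X A s (I j w, xi j w), approx_step X A s (I j w, xi j w)).
Proof.
rewrite /I/=; congr pair; rewrite mlmc_iterE approx_stepE//; exact: mlmc_input_in.
Qed.

Let step_pair (v : (E * E) * S) : (E * E)%type :=
  (approx_step X A s v, approx_step X A s v).

Let measurable_step_pair : measurable_fun setT step_pair.
Proof. by apply: measurable_fun_pair; apply: measurable_approx_step hA _ Xs. Qed.

Lemma measurable_mlmc_input j : measurable_fun setT (I j).
Proof.
elim: j => [|j ih]; first exact: measurable_cst.
have -> : I j.+1 = step_pair \o (fun w => (I j w, xi j w)).
  by apply/funext => w; rewrite mlmc_inputS.
exact: (measurableT_comp measurable_step_pair (measurable_fun_pair ih _)).
Qed.

Let Im j : {mfun O >-> (E * E)%type} := mfun_Sub (mem_set (measurable_mlmc_input j)).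

Lemma mlmc_input_indep j : indep_future xi Jp j (I j).
Proof.
elim: j => [|j ih]; first exact: (indep_future_cst hrand).
have -> : I j.+1 = (fun w => step_pair (I j w, xi j w)).
  by apply/funext => w; rewrite mlmc_inputS.
exact: (indep_future_step hrand (Y := Im j)).
Qed.

Let mgap j : measurable_fun setT (fun w => (prox_divergence X F lam s (I j w))%:E).
Proof.
apply/measurable_EFinP; apply: measurable_prox_divergence_comp => //.
- exact: measurable_mlmc_input.
- exact: mlmc_input_in.
Qed.

Lemma mlmc_gap_bound j :
  \int[P]_w (prox_divergence X F lam s (I j w))%:E <= (D * 8^-1 ^+ j)%:E.
Proof.
elim: j => [|j ih].
  rewrite (_ : (fun w => _) = cst D%:E)// integral_cst//= expr0 mulr1.
  by rewrite (@probability_setT _ _ _ P) mule1.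
under eq_integral do rewrite mlmc_inputS.
apply: le_trans (approx_step_contracts hXclosed hXconvex hFconvex hFdiff hlam hA Xs
  (I := Im j) (z := xi j) _ _ _) _.
- exact: mlmc_input_in.
- exact: (seed_law hrand).
- by move=> B C mB mC; exact: (indep_future_seed (@mlmc_input_indep j) mB mC).
by rewrite exprS mulrCA EFinM lee_pmul2l// lte_fin.
Qed.

Let mx j : measurable_fun setT (x j : O -> E).
Proof. exact: (measurableT_comp measurable_fst (measurable_mlmc_input j.+1)). Qed.

Let Y j : {mfun O >-> E} := mfun_Sub (mem_set (mx j)).
(* [2 / lam] turns divergence into squared distance; the factor [8^-1] is there because
   [x j] is the outcome of [j + 1] calls. *)
Let K : R := (2 / lam * (8^-1 * D))%R.

Lemma iterate_moment j :
  \int[P]_w (enorm (x j w - xs) ^+ 2)%:E <= (K * 8^-1 ^+ j)%:E.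
Proof.
have l0 : (0 < 2 / lam)%R by rewrite divr_gt0.
have XY w : X (I j.+1 w).1 /\ X (I j.+1 w).2 by exact: mlmc_input_in.
apply: (@le_trans _ _
    (\int[P]_w ((2 / lam)%:E * (prox_divergence X F lam s (I j.+1 w))%:E))).
  apply: ge0_le_integral => //.
  - by move=> w _; rewrite lee_fin sqr_ge0.
  - apply/measurable_EFinP.
    exact: (measurableT_comp (measurable_enorm_sqr xs) (mx j)).
  - exact: measurable_funeM.
  move=> w _; rewrite -EFinM lee_fin /prox_divergence mulrDr /bregman_e.
  have [_ X2] := XY w.
  have Xxs : X xs by exact: prox_in.
  have V0 := bregman_ge0 hXconvex hFconvex hFdiff Xxs X2.
  rewrite -[leLHS]addr0; apply: lerD; last by rewrite mulr_ge0// ltW.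
  rewrite le_eqVlt; apply/orP; left; apply/eqP.
  by rewrite /I/= -/(x j w); field; rewrite gt_eqF.
rewrite ge0_integralZl//; last 2 first.
- by move=> w _; rewrite lee_fin; apply: prox_divergence_ge0.
- by rewrite lee_fin ltW.
rewrite (_ : (K * 8^-1 ^+ j)%:E = (2 / lam)%:E * (D * 8^-1 ^+ j.+1)%:E); last first.
  by rewrite -EFinM /K exprS; congr EFin; ring.
by apply: lee_wpmul2l; [rewrite lee_fin ltW|exact: mlmc_gap_bound].
Qed.

Lemma Jp_level k : P (Jp @^-1` [set k]) = (2^-1 ^+ k.+1)%:E.
Proof.
have := Jp_law hrand k; rewrite /distribution/pushforward => ->.
by congr EFin; rewrite exprS; congr (_ * _)%R; lra.
Qed.

Lemma iterate_level_indep j B C : measurable B -> measurable C ->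
  P (Y j @^-1` B `&` Jp @^-1` C) = P (Y j @^-1` B) * P (Jp @^-1` C).
Proof.
move=> mB _; have mB' : measurable ((fst : E * E -> E) @^-1` B).
  by rewrite -[X in measurable X]setTI; exact: measurable_fst.
exact: (indep_future_level C (@mlmc_input_indep j.+1) mB').
Qed.

Let K_ge0 : (0 <= K)%R.
Proof.
rewrite !mulr_ge0 ?invr_ge0// ?(ltW hlam)//.
exact: prox_divergence_ge0.
Qed.

Variable j0 : nat.

Lemma mlmc_debiased w :
  (mlmc A 2^-1 j0 s xprev (xi^~ w) (Jp w)).1 = debiased Y Jp j0 w.
Proof.
rewrite /mlmc/= /debiased /debiased_at exprS.
by have -> : (1 - 2^-1 = 2^-1 :> R)%R by lra.
Qed.

Hypothesis j0_ge2 : (2 <= j0)%N.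

Lemma mlmc_unbiased :
  [/\ forall i, P.-integrable setT
         (fun w => ((mlmc A 2^-1 j0 s xprev (xi^~ w) (Jp w)).1 ord0 i)%:E),
      forall i, 'E_P[fun w => (mlmc A 2^-1 j0 s xprev (xi^~ w) (Jp w)).1 ord0 i] =
        (xs ord0 i)%:E &
      'E_P[fun w => (enorm ((mlmc A 2^-1 j0 s xprev (xi^~ w) (Jp w)).1 - xs) ^+ 2)%R]
        <= ((4 * lam)^-1 * (lam * bregman_e xs s + bregman X F xs xprev))%:E].
Proof.
split.
- move=> i; under eq_fun do rewrite mlmc_debiased.
  exact: (integrable_debiased j0 K_ge0 Jp_level iterate_level_indep iterate_moment).
- move=> i; rewrite unlock; under eq_integral do rewrite mlmc_debiased.
  exact: (debiased_mean j0 K_ge0 Jp_level iterate_level_indep iterate_moment).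
rewrite unlock; under eq_integral do rewrite mlmc_debiased.
have := debiased_moment j0 K_ge0 Jp_level iterate_level_indep iterate_moment.
move/le_trans; apply; rewrite lee_fin.
have D0 : (0 <= D)%R by exact: prox_divergence_ge0.
(* Two extra calls gain a factor 64, which exceeds the loss of 26. *)
have h8 : (8^-1 ^+ j0 <= 8^-1 ^+ 2 :> R)%R.
  by apply: ler_wiXn2l => //; rewrite ?invr_ge0// invf_le1// ler1n.
rewrite -[X in ((4 * lam)^-1 * X)%R]/D.
apply: (@le_trans _ _ (26 * (K * 8^-1 ^+ 2))%R).
  by rewrite ler_wpM2l// ler_wpM2l.
have -> : (26 * (K * 8^-1 ^+ 2) = 26 / 64 * ((4 * lam)^-1 * D))%R.
  by rewrite /K; field; rewrite gt_eqF.
by rewrite ler_piMl ?mulr_ge0 ?invr_ge0 ?mulr_ge0 ?(ltW hlam)//; lra.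
Qed.

Lemma mlmc_expected_calls :
  'E_P[fun w => (mlmc A 2^-1 j0 s xprev (xi^~ w) (Jp w)).2%:R] = (2 + j0)%:R%:E.
Proof.
rewrite unlock; under eq_integral do rewrite /mlmc/= mlmc_iter_calls.
apply: (ge0_integral_levels (N := Jp) _ _ _ (@cvg_sum_arith_geometric R j0)).
- apply/measurable_EFinP.
  by apply: (measurable_fun_level (N := Jp) (g := fun k _ => (j0 + k).+1%:R : R)).
- by move=> w; rewrite lee_fin.
move=> k; rewrite (@eq_integral _ _ _ P _ (cst (j0 + k).+1%:R%:E)).
  rewrite integral_cst//; first by rewrite EFinM -Jp_level.
  by rewrite -[X in measurable X]setTI; exact: measurable_funP.
by move=> w; rewrite inE => /= ->.
Qed.

End Unbiased.

Unset Implicit Arguments.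
Set Strict Implicit.
Set Printing Implicit Defensive.

Theorem proposition1 (R : realType) (d : nat) (X : set 'rV[R]_d)
    (F : 'rV[R]_d -> R) (lam : R)
    (hX0 : X !=set0) (hXclosed : closed X) (hXconvex : convex_set X)
    (hFconvex : convex_function X F) (hFdiff : differentiable_on X F)
    (hlam : 0 < lam)
    (dS : measure_display) (S : measurableType dS) (PS : probability S R)
    (A : 'rV[R]_d -> 'rV[R]_d -> 'rV[R]_d -> S -> 'rV[R]_d)
    (hA : is_approx_prox X F lam PS A)
    (dO : measure_display) (O : measurableType dO) (P : probability O R)
    (xi : nat -> {RV P >-> S}) (Jp : {RV P >-> nat})
    (hrand : mlmc_randomness PS 2^-1 xi Jp)
    (j0 : nat) (hj0 : (2 <= j0)%N) :
  implements_unbiased_prox X F lam P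
    (fun s xprev w => (mlmc A 2^-1 j0 s xprev (fun n => xi n w) (Jp w)).1)
  /\
  (forall s xprev, X s -> X xprev ->
    'E_P[fun w => (mlmc A 2^-1 j0 s xprev (fun n => xi n w) (Jp w)).2%:R]%E
      = (2 + j0)%:R%:E).
Proof.
split=> [s xprev Xs Xp|s xprev Xs Xp].
  by apply: (mlmc_unbiased hXclosed hXconvex hFconvex hFdiff hlam hA hrand).
exact: (mlmc_expected_calls A hrand).
Qed.
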